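(* Let $(A,\mu,\partial)$ be a multivariable GDQ ring with gradient $\partial=(\partial_1,\dots,\partial_n)$. Suppose that: (a) there exists a divergence $\partial^\star=(\partial^\star_1,\dots,\partial^\star_n)$ for $(A,\mu,\partial)$; put $N:=\sum_{i=1}^n\partial_i^\star\circ\partial_i$; (b) the operator $N_2:=N\otimes\mathrm{id}_A+\mathrm{id}_A\otimes N+\mathrm{id}_{A\otimes A}$ on $A\otimes A$ is injective, and the ranges of $\partial^\star:(A\otimes A)^n\to A$ and $N:A\to A$ satisfy $\operatorname{ran}\partial^\star\subseteq\operatorname{ran}N$. Then, for any $u=(u_1,\dots,u_n)\in(A\otimes A)^n$, the following statements are equivalent: (i) $u$ is a free gradient, i.e., there exists $a\in A$ such that $\partial a=u$. (ii) $u$ is irrotational. (iii) $\partial_j(\partial^\star u)=N_2u_j$ for $j=1,\dots,n$.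
   Context: Algebras are associative complex algebras (not necessarily unital); tensor products are algebraic over $\mathbb{C}$. $A\otimes A$ is an $A$-bimodule via $b_1\cdot(a_1\otimes a_2)\cdot b_2=(b_1a_1)\otimes(a_2b_2)$. A multivariable GDQ (generalized difference quotient) ring is a triple $(A,\mu,\partial)$ of a complex algebra $A$, its multiplication map $\mu:A\otimes A\to A$, $\mu(a_1\otimes a_2)=a_1a_2$, and an $n$-tuple $\partial=(\partial_1,\dots,\partial_n)$ of linear maps $\partial_i:A\to A\otimes A$ such that $(\partial_i\otimes\mathrm{id}_A)\circ\partial_j=(\mathrm{id}_A\otimes\partial_j)\circ\partial_i$ for all $i,j$, and each $\partial_i$ is a derivation: $\partial_i(a_1a_2)=(\partial_ia_1)\cdot a_2+a_1\cdot(\partial_ia_2)$. The gradient is viewed as the linear map $\partial:A\to(A\otimes A)^n$. A divergence for $(A,\mu,\partial)$ is an $n$-tuple $\partial^\star=(\partial_1^\star,\dots,\partial_n^\star)$ of linear maps $\partial_i^\star:A\otimes A\to A$ with $\partial_j\circ\partial_i^\star=(\partial_i^\star\otimes\mathrm{id}_A)\circ(\mathrm{id}_A\otimes\partial_j)+(\mathrm{id}_A\otimes\partial_i^\star)\circ(\partial_j\otimes\mathrm{id}_A)+\delta_{i,j}\mathrm{id}_{A\otimes A}$ for all $i,j$; it is viewed as the linear map $\partial^\star:(A\otimes A)^n\to A$, $\partial^\star(u)=\sum_{j=1}^n\partial_j^\star(u_j)$. A tuple $u\in(A\otimes A)^n$ is irrotational if $(\mathrm{id}_A\otimes\partial_i)(u_j)=(\partial_j\otimes\mathrm{id}_A)(u_i)$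 for all $i,j=1,\dots,n$. *)

(* Defs.v *)
From HB Require Import structures.
From mathcomp Require Import all_boot all_order all_algebra.
From mathcomp Require Import generic_quotient boolp classical_sets reals.
From mathcomp Require Import complex.

Set Implicit Arguments.
Unset Strict Implicit.
Unset Printing Implicit Defensive.

Import GRing.Theory.

Local Open Scope ring_scope.
Local Open Scope quotient_scope.

(* MathComp has no tensor product of arbitrary modules.  Here it is the set of
   formal finite sums of pairs, a list [:: (u1, v1); ...; (uk, vk)] standing for
   u1 ⊗ v1 + ... + uk ⊗ vk, modulo the congruence generated by commutativity,
   biadditivity and balancedness.  The rule tens_rel_00 is needed because lists
   form only a monoid: with it, (- u, v) becomes an inverse of (u, v).  The
   universal property is tens_liftE together with tens_linear_ext. *)
Section TensorProduct.
Variables (K : comNzRingType) (U V : lmodType K).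

Inductive tens_rel : seq (U * V) -> seq (U * V) -> Prop :=
| tens_rel_refl s : tens_rel s s
| tens_rel_sym s t : tens_rel s t -> tens_rel t s
| tens_rel_trans s t r : tens_rel s t -> tens_rel t r -> tens_rel s r
| tens_rel_cat s s' t t' :
    tens_rel s s' -> tens_rel t t' -> tens_rel (s ++ t) (s' ++ t')
| tens_rel_catC s t : tens_rel (s ++ t) (t ++ s)
| tens_rel_00 : tens_rel [:: (0, 0)] [::]
| tens_rel_addl u u' v : tens_rel [:: (u + u', v)] [:: (u, v); (u', v)]
| tens_rel_addr u v v' : tens_rel [:: (u, v + v')] [:: (u, v); (u, v')]
| tens_rel_scale c u v : tens_rel [:: (c *: u, v)] [:: (u, c *: v)].

Definition tens_relb (s t : seq (U * V)) : bool := `[< tens_rel s t >].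

Fact tens_relb_refl : reflexive tens_relb.
Proof. by move=> s; apply/asboolP; apply: tens_rel_refl. Qed.

Fact tens_relb_sym : symmetric tens_relb.
Proof.
by move=> s t; apply/asboolP/asboolP => h; apply: tens_rel_sym.
Qed.

Fact tens_relb_trans : transitive tens_relb.
Proof.
move=> t s r /asboolP st /asboolP tr; apply/asboolP.
exact: tens_rel_trans st tr.
Qed.

Canonical tens_equiv := EquivRel tens_relb
  tens_relb_refl tens_relb_sym tens_relb_trans.

Definition tens_quot := {eq_quot tens_equiv}.

HB.instance Definition _ := Choice.on tens_quot.
HB.instance Definition _ := EqQuotient.on tens_quot.

Lemma tens_relP s t : reflect (\pi_tens_quot s = \pi_tens_quot t) (tens_relb s t).
Proof. exact: (@eqquotP _ tens_equiv tens_quot s t). Qed.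

Lemma tens_pi s t : tens_rel s t -> \pi_tens_quot s = \pi_tens_quot t.
Proof. by move=> h; apply/tens_relP/asboolP. Qed.

Lemma tens_repr s : tens_rel (repr (\pi_tens_quot s)) s.
Proof. by apply/asboolP/tens_relP; rewrite reprK. Qed.

Definition tens_scale_seq (c : K) (s : seq (U * V)) :=
  [seq (c *: p.1, p.2) | p <- s].

Lemma tens_scale_rel c s t :
  tens_rel s t -> tens_rel (tens_scale_seq c s) (tens_scale_seq c t).
Proof.
elim=> {s t} [s|s t _ h|s t r _ h1 _ h2|s s' t t' _ h1 _ h2|s t||u u' v|u v v'
  |b u v].
- exact: tens_rel_refl.
- exact: tens_rel_sym.
- exact: tens_rel_trans h1 h2.
- by rewrite /tens_scale_seq !map_cat; apply: tens_rel_cat.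
- by rewrite /tens_scale_seq !map_cat; apply: tens_rel_catC.
- by rewrite /= scaler0; apply: tens_rel_00.
- by rewrite /= scalerDr; apply: tens_rel_addl.
- exact: tens_rel_addr.
- by rewrite /= scalerA mulrC -scalerA; apply: tens_rel_scale.
Qed.

Definition tens_zero : tens_quot := \pi_tens_quot [::].
Definition tens_add (x y : tens_quot) : tens_quot := \pi_tens_quot (repr x ++ repr y).
Definition tens_smul (c : K) (x : tens_quot) : tens_quot :=
  \pi_tens_quot (tens_scale_seq c (repr x)).
Definition tens_opp (x : tens_quot) : tens_quot := tens_smul (-1) x.

Fact tens_add_pi s t :
  tens_add (\pi_tens_quot s) (\pi_tens_quot t) = \pi_tens_quot (s ++ t).
Proof. by apply: tens_pi; apply: tens_rel_cat; apply: tens_repr. Qed.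

Fact tens_smul_pi c s :
  tens_smul c (\pi_tens_quot s) = \pi_tens_quot (tens_scale_seq c s).
Proof. by apply: tens_pi; apply: tens_scale_rel; apply: tens_repr. Qed.

Fact tens_addA : associative tens_add.
Proof.
elim/quotW=> s; elim/quotW=> t; elim/quotW=> r.
rewrite (tens_add_pi t r) (tens_add_pi s t) (tens_add_pi s) (tens_add_pi _ r).
by rewrite catA.
Qed.

Fact tens_addC : commutative tens_add.
Proof. by move=> x y; apply: tens_pi; apply: tens_rel_catC. Qed.

Fact tens_add0 : left_id tens_zero tens_add.
Proof. by elim/quotW=> s; rewrite tens_add_pi. Qed.

Lemma tens_rel_0l v : tens_rel [:: (0, v)] [::].
Proof.
apply: tens_rel_trans tens_rel_00.
rewrite -[X in (X, v)](scaler0 _ 0) -[X in tens_rel _ [:: (_, X)]](scale0r v).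
exact: tens_rel_scale.
Qed.

Lemma tens_smulDl_seq a b s :
  tens_rel (tens_scale_seq (a + b) s)
           (tens_scale_seq a s ++ tens_scale_seq b s).
Proof.
elim: s => [|[u v] s IHs] /=; first exact: tens_rel_refl.
rewrite scalerDl -cat1s.
apply: tens_rel_trans (tens_rel_cat (tens_rel_addl _ _ _) IHs) _ => /=.
rewrite -cat1s -[X in tens_rel _ X]cat1s.
apply: tens_rel_cat; first exact: tens_rel_refl.
rewrite -cat1s -[(b *: u, v) :: tens_scale_seq b s]cat1s !catA.
apply: tens_rel_cat; last exact: tens_rel_refl.
exact: tens_rel_catC.
Qed.

Fact tens_smulDl x : {morph tens_smul^~ x : a b / a + b >-> tens_add a b}.
Proof.
move=> a b; elim/quotW: x => s.
rewrite (tens_smul_pi (a + b)) (tens_smul_pi a) (tens_smul_pi b) tens_add_pi.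
exact/tens_pi/tens_smulDl_seq.
Qed.

Fact tens_smul1 : left_id 1 tens_smul.
Proof.
elim/quotW=> s; rewrite tens_smul_pi; congr (\pi_tens_quot _).
by rewrite -[RHS]map_id; apply: eq_map => -[u v] /=; rewrite scale1r.
Qed.

Fact tens_smul0 x : tens_smul 0 x = tens_zero.
Proof.
elim/quotW: x => s; rewrite tens_smul_pi; apply: tens_pi.
elim: s => [|[u v] s IHs] /=; first exact: tens_rel_refl.
by rewrite scale0r -cat1s -[X in tens_rel _ X]cat0s; apply: tens_rel_cat IHs;
  apply: tens_rel_0l.
Qed.

Fact tens_addN : left_inverse tens_zero tens_opp tens_add.
Proof.
move=> x; rewrite /tens_opp -{2}[x]tens_smul1 -tens_smulDl.
by rewrite addNr tens_smul0.
Qed.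

HB.instance Definition _ := GRing.isZmodule.Build tens_quot
  tens_addA tens_addC tens_add0 tens_addN.

Fact tens_smulA a b x : tens_smul a (tens_smul b x) = tens_smul (a * b) x.
Proof.
elim/quotW: x => s.
rewrite (tens_smul_pi b) (tens_smul_pi a) tens_smul_pi; congr (\pi_tens_quot _).
by rewrite /tens_scale_seq -map_comp; apply: eq_map => p /=; rewrite scalerA.
Qed.

Fact tens_smulDr : right_distributive tens_smul +%R.
Proof.
move=> a; elim/quotW=> s; elim/quotW=> t.
rewrite (tens_add_pi s t : _ + _ = _) (tens_smul_pi a s) (tens_smul_pi a t).
rewrite [RHS]tens_add_pi [LHS]tens_smul_pi.
by rewrite /tens_scale_seq map_cat.
Qed.

HB.instance Definition _ := GRing.Zmodule_isLmodule.Build K tens_quot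
  tens_smulA tens_smul1 tens_smulDr tens_smulDl.

Lemma tens_lin_pi c s t :
  c *: (\pi_tens_quot s) + \pi_tens_quot t = \pi_tens_quot (tens_scale_seq c s ++ t).
Proof.
exact: etrans (congr1 (tens_add^~ _) (tens_smul_pi c s)) (tens_add_pi _ _).
Qed.

Definition tensor : lmodType K := GRing.Lmodule.clone K tens_quot _.

Definition tens (u : U) (v : V) : tensor := \pi_tens_quot [:: (u, v)].

Fact tens_is_bilinear :
  bilinear_for (GRing.Scale.Law.clone _ _ *:%R _)
    (GRing.Scale.Law.clone _ _ *:%R _) tens.
Proof.
split=> [v c u u'|u c v v'].
- apply: etrans (esym (tens_lin_pi c [:: (u, v)] [:: (u', v)])).
  exact/tens_pi/tens_rel_addl.
- apply: etrans (esym (tens_lin_pi c [:: (u, v)] [:: (u, v')])).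
  apply: tens_pi; apply: tens_rel_trans (tens_rel_addr _ _ _) _.
  rewrite -cat1s -[X in tens_rel _ X]cat1s; apply: tens_rel_cat.
    exact/tens_rel_sym/tens_rel_scale.
  exact: tens_rel_refl.
Qed.

HB.instance Definition _ :=
  bilinear_isBilinear.Build K U V tensor _ _ tens tens_is_bilinear.

Lemma tens_pi_sum s : \pi_tens_quot s = \sum_(p <- s) tens p.1 p.2.
Proof.
elim: s => [|[u v] s IHs]; first by rewrite big_nil.
by rewrite big_cons -IHs [RHS]tens_add_pi.
Qed.

Lemma tensP (x : tensor) : exists s, x = \sum_(p <- s) tens p.1 p.2.
Proof. by exists (repr x); rewrite -tens_pi_sum reprK. Qed.

Section Lift.
Variables (W : lmodType K) (f : {bilinear U -> V -> W}).

Definition tens_lift (x : tensor) : W := \sum_(p <- repr x) f p.1 p.2.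

Lemma tens_lift_rel s t :
  tens_rel s t -> \sum_(p <- s) f p.1 p.2 = \sum_(p <- t) f p.1 p.2.
Proof.
elim=> {s t} [s|s t _ h|s t r _ h1 _ h2|s s' t t' _ h1 _ h2|s t||u u' v|u v v'
  |b u v] //=.
- by rewrite h1.
- by rewrite !big_cat /= h1 h2.
- by rewrite !big_cat /= addrC.
- by rewrite big_seq1 big_nil linear0r.
- by rewrite !big_cons big_nil /= !addr0 linearDl.
- by rewrite !big_cons big_nil /= !addr0 linearDr.
- by rewrite !big_seq1 /= linearZl_LR linearZr_LR.
Qed.

Lemma tens_lift_pi s : tens_lift (\pi_tens_quot s) = \sum_(p <- s) f p.1 p.2.
Proof. exact/tens_lift_rel/tens_repr. Qed.

Fact tens_lift_is_linear : linear tens_lift.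
Proof.
move=> c; elim/quotW=> s; elim/quotW=> t.
rewrite (tens_lin_pi c s t) !tens_lift_pi big_cat big_map scaler_sumr.
by congr (_ + _); apply: eq_bigr => p _ /=; rewrite linearZl_LR.
Qed.

HB.instance Definition _ :=
  GRing.isLinear.Build K tensor W *:%R tens_lift tens_lift_is_linear.

Lemma tens_liftE u v : tens_lift (tens u v) = f u v.
Proof. by rewrite tens_lift_pi big_seq1. Qed.

End Lift.

Lemma tens_linear_ext (W : lmodType K) (f g : {linear tensor -> W}) :
  (forall u v, f (tens u v) = g (tens u v)) -> f =1 g.
Proof.
move=> fg x; have [s ->] := tensP x.
by rewrite !linear_sum; apply: eq_bigr => p _.
Qed.

End TensorProduct.

Arguments tens_linear_ext {K U V W f g}.

Notation "u '*t' v" := (tens u v) (at level 40, left associativity) : ring_scope.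

Section TensorMap.
Variables (K : comNzRingType) (U V U' V' : lmodType K).
Variables (f : {linear U -> U'}) (g : {linear V -> V'}).

Definition tens_map_fun (u : U) (v : V) : tensor U' V' := f u *t g v.

Fact tens_map_is_bilinear :
  bilinear_for (GRing.Scale.Law.clone _ _ *:%R _)
    (GRing.Scale.Law.clone _ _ *:%R _) tens_map_fun.
Proof.
split=> [v c u u'|u c v v']; rewrite /tens_map_fun.
- by rewrite linearP linearPl.
- by rewrite linearP linearPr.
Qed.

HB.instance Definition _ :=
  bilinear_isBilinear.Build K U V _ _ _ tens_map_fun tens_map_is_bilinear.

Definition tens_map : tensor U V -> tensor U' V' := tens_lift tens_map_fun.

HB.instance Definition _ := GRing.Linear.on tens_map.

Lemma tens_mapE u v : tens_map (u *t v) = f u *t g v.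
Proof. exact: tens_liftE. Qed.

End TensorMap.

Section Associator.
Variables (K : comNzRingType) (U V W : lmodType K).

Definition assoc_inner (w : W) (u : U) (v : V) : tensor U (tensor V W) :=
  u *t (v *t w).

Fact assoc_inner_is_bilinear w :
  bilinear_for (GRing.Scale.Law.clone _ _ *:%R _)
    (GRing.Scale.Law.clone _ _ *:%R _) (assoc_inner w).
Proof.
split=> [v c u u'|u c v v']; rewrite /assoc_inner.
- by rewrite linearPl.
- by rewrite linearPl linearPr.
Qed.

HB.instance Definition _ w :=
  bilinear_isBilinear.Build K U V _ _ _ (assoc_inner w)
    (assoc_inner_is_bilinear w).

Definition assoc_outer (x : tensor U V) (w : W) : tensor U (tensor V W) :=
  tens_lift (assoc_inner w) x.

Fact assoc_outer_is_bilinear :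
  bilinear_for (GRing.Scale.Law.clone _ _ *:%R _)
    (GRing.Scale.Law.clone _ _ *:%R _) assoc_outer.
Proof.
split=> [w c x y|x c w w']; rewrite /assoc_outer; first by rewrite linearP.
have [s ->] := tensP x; rewrite !linear_sum /= scaler_sumr -big_split.
apply: eq_bigr => p _; rewrite /= !tens_liftE /= /assoc_inner.
by rewrite !linearPr.
Qed.

HB.instance Definition _ :=
  bilinear_isBilinear.Build K _ W _ _ _ assoc_outer assoc_outer_is_bilinear.

Definition tens_assoc : tensor (tensor U V) W -> tensor U (tensor V W) :=
  tens_lift assoc_outer.

HB.instance Definition _ := GRing.Linear.on tens_assoc.

Lemma tens_assocE u v w : tens_assoc (u *t v *t w) = u *t (v *t w).
Proof. by rewrite /tens_assoc tens_liftE /= /assoc_outer tens_liftE. Qed.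

Definition assocV_inner (u : U) (v : V) (w : W) : tensor (tensor U V) W :=
  u *t v *t w.

Fact assocV_inner_is_bilinear u :
  bilinear_for (GRing.Scale.Law.clone _ _ *:%R _)
    (GRing.Scale.Law.clone _ _ *:%R _) (assocV_inner u).
Proof.
split=> [w c v v'|v c w w']; rewrite /assocV_inner.
- by rewrite linearPr linearPl.
- by rewrite linearPr.
Qed.

HB.instance Definition _ u :=
  bilinear_isBilinear.Build K V W _ _ _ (assocV_inner u)
    (assocV_inner_is_bilinear u).

Definition assocV_outer (u : U) (x : tensor V W) : tensor (tensor U V) W :=
  tens_lift (assocV_inner u) x.

Fact assocV_outer_is_bilinear :
  bilinear_for (GRing.Scale.Law.clone _ _ *:%R _)
    (GRing.Scale.Law.clone _ _ *:%R _) assocV_outer.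
Proof.
split=> [x c u u'|u c x y]; rewrite /assocV_outer; last by rewrite linearP.
have [s ->] := tensP x; rewrite !linear_sum /= scaler_sumr -big_split.
apply: eq_bigr => p _; rewrite /= !tens_liftE /= /assocV_inner.
by rewrite !linearPl.
Qed.

HB.instance Definition _ :=
  bilinear_isBilinear.Build K U _ _ _ _ assocV_outer assocV_outer_is_bilinear.

Definition tens_assocV : tensor U (tensor V W) -> tensor (tensor U V) W :=
  tens_lift assocV_outer.

HB.instance Definition _ := GRing.Linear.on tens_assocV.

Lemma tens_assocVE u v w : tens_assocV (u *t (v *t w)) = u *t v *t w.
Proof. by rewrite /tens_assocV tens_liftE /= /assocV_outer tens_liftE. Qed.

Lemma tens_assocK : cancel tens_assoc tens_assocV.
Proof.
move=> x; have [s ->] := tensP x.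
elim/big_ind: _ => [|y z hy hz|[y w] _ /=]; first by rewrite !linear0.
  by rewrite linearD /= linearD /= hy hz.
have [r ->] := tensP y.
elim/big_ind: _ => [|y1 y2 h1 h2|[u v] _ /=]; first by rewrite linear0l !linear0.
  by rewrite linearDl linearD /= linearD /= h1 h2.
by rewrite tens_assocE tens_assocVE.
Qed.

Lemma tens_assocVK : cancel tens_assocV tens_assoc.
Proof.
move=> x; have [s ->] := tensP x.
elim/big_ind: _ => [|y z hy hz|[u y] _ /=]; first by rewrite !linear0.
  by rewrite linearD /= linearD /= hy hz.
have [r ->] := tensP y.
elim/big_ind: _ => [|y1 y2 h1 h2|[v w] _ /=]; first by rewrite linear0r !linear0.
  by rewrite linearDr linearD /= linearD /= h1 h2.
by rewrite tens_assocVE tens_assocE.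
Qed.

End Associator.

(* The multiplication of a not necessarily unital algebra is a linear map
   mu : A ⊗ A -> A. *)
Section Bimodule.
Variables (K : comNzRingType) (A : lmodType K) (mu : {linear tensor A A -> A}).

Definition lmul (b a : A) : A := mu (b *t a).

Fact lmul_is_linear b : linear (lmul b).
Proof. by move=> c x y; rewrite /lmul linearPr linearP. Qed.

HB.instance Definition _ b :=
  GRing.isLinear.Build K A A *:%R (lmul b) (lmul_is_linear b).

Definition rmul (b a : A) : A := mu (a *t b).

Fact rmul_is_linear b : linear (rmul b).
Proof. by move=> c x y; rewrite /rmul linearPl linearP. Qed.

HB.instance Definition _ b :=
  GRing.isLinear.Build K A A *:%R (rmul b) (rmul_is_linear b).

(* b · (a1 ⊗ a2) = (b a1) ⊗ a2   and   (a1 ⊗ a2) · b = a1 ⊗ (a2 b) *)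
Definition lact (b : A) (x : tensor A A) : tensor A A :=
  tens_map (lmul b) idfun x.
Definition ract (x : tensor A A) (b : A) : tensor A A :=
  tens_map idfun (rmul b) x.

End Bimodule.

Section GDQ.
Variables (K : comNzRingType) (A : lmodType K) (n : nat).

(* In coassociativity, and below, (A ⊗ A) ⊗ A and A ⊗ (A ⊗ A) are identified
   through tens_assoc and its inverse tens_assocV. *)
Record is_GDQ_ring (mu : {linear tensor A A -> A})
    (d : 'I_n -> {linear A -> tensor A A}) : Prop := IsGDQRing {
  gdq_mulA : forall a b c : A, mu (mu (a *t b) *t c) = mu (a *t mu (b *t c));
  gdq_coassoc : forall (i j : 'I_n) (a : A),
    tens_assoc (tens_map (d i) idfun (d j a)) = tens_map idfun (d j) (d i a);
  gdq_derivation : forall (i : 'I_n) (a1 a2 : A),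
    d i (mu (a1 *t a2)) = ract mu (d i a1) a2 + lact mu a1 (d i a2) }.

Definition is_divergence (d : 'I_n -> {linear A -> tensor A A})
    (ds : 'I_n -> {linear tensor A A -> A}) : Prop :=
  forall (i j : 'I_n) (x : tensor A A),
    d j (ds i x) = tens_map (ds i) idfun (tens_assocV (tens_map idfun (d j) x))
                 + tens_map idfun (ds i) (tens_assoc (tens_map (d j) idfun x))
                 + (if i == j then x else 0).

Definition gradient (d : 'I_n -> {linear A -> tensor A A}) (a : A) :
    {ffun 'I_n -> tensor A A} := [ffun i => d i a].

Fact gradient_is_linear d : linear (gradient d).
Proof. by move=> c x y; apply/ffunP => i; rewrite !ffunE linearP. Qed.

HB.instance Definition _ d := GRing.isLinear.Build K A _ *:%R (gradient d)
  (gradient_is_linear d).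

Definition divergence (ds : 'I_n -> {linear tensor A A -> A})
    (u : {ffun 'I_n -> tensor A A}) : A := \sum_(j < n) ds j (u j).

Fact divergence_is_linear ds : linear (divergence ds).
Proof.
move=> c x y; rewrite /divergence scaler_sumr -big_split; apply: eq_bigr => j _.
by rewrite !ffunE linearP.
Qed.

HB.instance Definition _ ds := GRing.isLinear.Build K _ A *:%R (divergence ds)
  (divergence_is_linear ds).

Definition irrotational (d : 'I_n -> {linear A -> tensor A A})
    (u : {ffun 'I_n -> tensor A A}) : Prop :=
  forall i j : 'I_n,
    tens_map idfun (d i) (u j) = tens_assoc (tens_map (d j) idfun (u i)).

Section NumberOperators.
Variables (d : 'I_n -> {linear A -> tensor A A}).
Variables (ds : 'I_n -> {linear tensor A A -> A}).

Definition number_op (a : A) : A := \sum_(i < n) ds i (d i a).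

Fact number_op_is_linear : linear number_op.
Proof.
move=> c x y; rewrite /number_op scaler_sumr -big_split; apply: eq_bigr => i _.
by rewrite !linearP.
Qed.

HB.instance Definition _ := GRing.isLinear.Build K A A *:%R number_op
  number_op_is_linear.

Definition number_op2 (x : tensor A A) : tensor A A :=
  tens_map number_op idfun x + tens_map idfun number_op x + x.

Fact number_op2_is_linear : linear number_op2.
Proof.
move=> c x y; rewrite /number_op2 !linearP /= !scalerDr.
by rewrite [RHS]addrACA; congr (_ + _); rewrite [LHS]addrACA.
Qed.

HB.instance Definition _ := GRing.isLinear.Build K _ _ *:%R number_op2
  number_op2_is_linear.

End NumberOperators.

End GDQ.

(* Main.v *)
(* For irrotational u the divergence identity moves every derivative in
   d_j (ds u) from u_i onto u_j, which gives the formula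
   d_j (ds u) = N2 u_j.  Applied to u = gradient a it reads
   d_j (N a) = N2 (d_j a).  So if u satisfies the formula and a is chosen with
   N a = ds u, then N2 (d_j a) = N2 u_j, and N2 is injective. *)

Require Import Defs.
From mathcomp Require Import all_boot all_order all_algebra.
From mathcomp Require Import boolp classical_sets reals complex.

Set Implicit Arguments.
Unset Strict Implicit.
Unset Printing Implicit Defensive.

Import GRing.Theory.

Local Open Scope classical_set_scope.
Local Open Scope ring_scope.

Section FreeGradients.
Variables (K : comNzRingType) (A : lmodType K) (n : nat).
Variables (d : 'I_n -> {linear A -> tensor A A}).
Variables (ds : 'I_n -> {linear tensor A A -> A}).

(** Linearity in [x] reduces this to pure tensors. It and its right-hand analogue supply the first
    two terms of [number_op2]. *)
Lemma sum_tens_map_number_opl x :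
  \sum_(i < n) tens_map (ds i) idfun (tens_map (d i) idfun x)
  = tens_map (number_op d ds) idfun x :> tensor A A.
Proof.
have [s ->] := tensP x; rewrite linear_sum /=.
under eq_bigr => i _.
  rewrite (linear_sum (tens_map (d i) idfun)) (linear_sum (tens_map (ds i) idfun)) /=.
  over.
rewrite exchange_big /=; apply: eq_bigr => -[a b] _ /=.
by under eq_bigr do rewrite !tens_mapE; rewrite tens_mapE linear_sumlz.
Qed.

Lemma sum_tens_map_number_opr x :
  \sum_(i < n) tens_map idfun (ds i) (tens_map idfun (d i) x)
  = tens_map idfun (number_op d ds) x :> tensor A A.
Proof.
have [s ->] := tensP x; rewrite linear_sum /=.
under eq_bigr => i _.
  rewrite (linear_sum (tens_map idfun (d i))) (linear_sum (tens_map idfun (ds i))) /=.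
  over.
rewrite exchange_big /=; apply: eq_bigr => -[a b] _ /=.
by under eq_bigr do rewrite !tens_mapE; rewrite tens_mapE linear_sumr.
Qed.

(** This is coassociativity with [i] and [j] exchanged. *)
Lemma gradient_irrotational (mu : {linear tensor A A -> A}) a :
  is_GDQ_ring mu d -> irrotational d (gradient d a).
Proof. by move=> hA i j; rewrite !ffunE (gdq_coassoc hA). Qed.

Lemma irrotational_divergence (u : {ffun 'I_n -> tensor A A}) j :
  is_divergence d ds -> irrotational d u ->
  d j (divergence ds u) = number_op2 d ds (u j).
Proof.
move=> hds hu; rewrite /divergence linear_sum.
(* Irrotationality is used once in each direction: the first use creates a [tens_assoc] that cancels
   [tens_assocV], the second absorbs the remaining [tens_assoc]. *)
under eq_bigr => i _ do rewrite hds hu tens_assocK -hu.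
(* The Kronecker terms collapse to [u j], the last term of [number_op2]. *)
rewrite !big_split /= -big_mkcond big_pred1_eq.
by rewrite sum_tens_map_number_opl sum_tens_map_number_opr.
Qed.

End FreeGradients.

Theorem theorem4p5 (R : realType) (A : lmodType R[i])
    (mu : {linear tensor A A -> A}) (n : nat)
    (d : 'I_n -> {linear A -> tensor A A})
    (hA : is_GDQ_ring mu d)
    (ds : 'I_n -> {linear tensor A A -> A})
    (hds : is_divergence d ds)
    (hN2 : injective (number_op2 d ds))
    (hran : range (divergence ds) `<=` range (number_op d ds))
    (u : {ffun 'I_n -> tensor A A}) :
  [<-> exists a : A, gradient d a = u;
       irrotational d u;
       forall j : 'I_n, d j (divergence ds u) = number_op2 d ds (u j)].
Proof.
tfae.
- by case=> a <-; apply: gradient_irrotational hA.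
- by move=> hu j; apply: irrotational_divergence.
(* The range inclusion supplies the candidate potential [a]. *)
- move=> hu; have [|a _ Na] := hran (divergence ds u); first by exists u.
  exists a; apply/ffunP => j; apply: hN2; rewrite -hu -Na.
  (* What remains is that the divergence of [gradient d a] is [number_op d ds a]. *)
  rewrite -irrotational_divergence //; last exact: gradient_irrotational hA.
  by congr (d j _); apply: eq_bigr => i _; rewrite ffunE.
Qed.
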